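(* Let $m \ge 3$ be odd and $n = 3^m-1$. Then the dual code $\mathcal{C}_{(2,3,m)}^\perp$ has parameters $[n,k,d]$ with $d \ge \frac{3^{(m-1)/2}+15}{2}$ if $m \equiv 1 \pmod 4$ and $d \ge \frac{3^{(m-1)/2}+13}{2}$ if $m \equiv 3 \pmod 4$, and $k = \frac{n-2}{2}$ if $m \equiv 1 \pmod 4$ and $k = \frac{n}{2}$ if $m \equiv 3 \pmod 4$.
   Context: Let $m \ge 2$ be an integer, $n = 3^m-1$, and let $\alpha$ be a primitive element of $\mathbb{F}_{3^m}$. For an integer $0 \le j \le n-1$ with $3$-adic expansion $j = \sum_{t=0}^{m-1} j_t 3^t$, $j_t \in \{0,1,2\}$, let $w_3(j) = \sum_{t=0}^{m-1} j_t$. For distinct $i_1, i_2 \in \{0,1,2,3\}$ let $T_{(i_1,i_2,m)} = \{1 \le j \le n-1 : w_3(j) \equiv i_1 \text{ or } i_2 \pmod 4\}$ and $g_{(i_1,i_2,m)}(x) = \prod_{j \in T_{(i_1,i_2,m)}} (x - \alpha^j) \in \mathbb{F}_3[x]$. $\mathcal{C}_{(i_1,i_2,m)}$ denotes the ternary cyclic code of length $n$ with generator polynomial $g_{(i_1,i_2,m)}(x)$, and $\mathcal{C}^\perp$ denotes the dual code with respect to the standard inner product on $\mathbb{F}_3^n$. Parameters $[n,k,d]$ mean length, dimension over $\mathbb{F}_3$, and minimum Hamming distance. *)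

(* Defs.v *)
From mathcomp Require Import all_boot all_order all_algebra all_field.
Set Implicit Arguments. Unset Strict Implicit. Unset Printing Implicit Defensive.
Import GRing.Theory.
Local Open Scope ring_scope.

Definition w3 (m j : nat) : nat := (\sum_(t < m) ((j %/ 3 ^ t) %% 3))%N.

Definition Tset (i1 i2 m : nat) : seq nat :=
  [seq j <- iota 1 (3 ^ m - 2) | ((w3 m j %% 4 == i1) || (w3 m j %% 4 == i2))%N].

(* the canonical embedding F_3 -> L (L of characteristic 3) *)
Definition f3emb (L : fieldType) (x : 'F_3) : L := (nat_of_ord x)%:R.

Definition gpoly (L : fieldType) (alpha : L) (i1 i2 m : nat) : {poly L} :=
  \prod_(j <- Tset i1 i2 m) ('X - (alpha ^+ j)%:P).

Definition wpoly (L : fieldType) (N : nat) (c : 'rV['F_3]_N) : {poly L} :=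
  \sum_(i < N) (f3emb L (c ord0 i))%:P * 'X^i.

Definition cyc_code (L : finFieldType) (alpha : L) (i1 i2 m : nat)
  : {set 'rV['F_3]_(3 ^ m - 1)} :=
  [set c : 'rV['F_3]_(3 ^ m - 1) | gpoly alpha i1 i2 m %| wpoly L c].

Definition dual_code (N : nat) (C : {set 'rV['F_3]_N}) : {set 'rV['F_3]_N} :=
  [set v : 'rV['F_3]_N | [forall c in C, \sum_(i < N) v ord0 i * c ord0 i == 0]].

Definition code_dim (N : nat) (C : {set 'rV['F_3]_N}) : nat :=
  \dim <<enum C>>%VS.

Definition hwt (N : nat) (c : 'rV['F_3]_N) : nat := #|[set i | c ord0 i != 0]|.

(* Main.v *)
Require Import Defs.
From HB Require Import structures.
From mathcomp Require Import all_boot all_order all_algebra all_field.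
From mathcomp Require Import zify.

(** Write [n = 3 ^ m - 1] and [S j = c(alpha ^ (- j))]. A word [c] of the dual
    code satisfies [S j = 0] whenever [j mod n] has digit sum 0 or 1 modulo 4,
    because [(X ^ n - 1) / (X - alpha ^ j)] is then a multiple of the
    generator. With [m = 2 k + 1] and [h = (3 ^ k - 1) / 2], such exponents
    are found along the arithmetic progression of step
    [n / 2 + 3 ^ k + 1] ([k] odd) or [n / 2 + 3 ^ k - 1] ([k] even): in base
    [3 ^ k] the terms have two digits that are equal (resp. complementary) and
    a third one fixed by parity, which keeps their digit sum under control
    slightly past [h]. Both steps are prime to [n], so the BCH bound applies.
    For [m = 3] the run is one term too short and van Lint-Wilson shifting
    replaces the BCH bound. The dimension is the number of exponents of digit
    sum 2 or 3 modulo 4, counted by a two-term recursion on [m]. *)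

Set Implicit Arguments. Unset Strict Implicit. Unset Printing Implicit Defensive.
Import GRing.Theory.

(** * Ternary digit sums *)

Lemma w3S m j : w3 m.+1 j = j %% 3 + w3 m (j %/ 3).
Proof.
rewrite /w3 big_ord_recl expn0 divn1; congr (_ + _).
by apply: eq_bigr => t _; rewrite /= /bump /= add1n expnS divnMA.
Qed.

Lemma w3_0 m : w3 m 0 = 0.
Proof. by apply: big1 => t _; rewrite div0n mod0n. Qed.

Lemma w3_block k l a b : a < 3 ^ k -> w3 (k + l) (a + 3 ^ k * b) = w3 k a + w3 l b.
Proof.
elim: k a => [|k IHk] a.
  by rewrite expn0 mul1n ltnS leqn0 => /eqP ->; rewrite w3_0 !add0n.
move=> a_lt; rewrite addSn !w3S -addnA; congr (_ + _).
  by rewrite expnS -mulnA addnC mulnC modnMDl.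
have -> : (a + 3 ^ k.+1 * b) %/ 3 = a %/ 3 + 3 ^ k * b.
  by rewrite expnS -mulnA addnC mulnC divnMDl // addnC.
by rewrite IHk // ltn_divLR // -expnSr.
Qed.

Lemma w3_widen k l a : a < 3 ^ k -> w3 (k + l) a = w3 k a.
Proof. by move=> /(w3_block l 0); rewrite muln0 addn0 w3_0 addn0. Qed.

(** Subtracting from the all-2 number [3 ^ k - 1] needs no borrow: each digit [d] becomes
    [2 - d]. *)
Lemma w3_compl k a : a < 3 ^ k -> w3 k a + w3 k (3 ^ k - 1 - a) = k.*2.
Proof.
elim: k a => [|k IHk] a; first by rewrite /w3 !big_ord0.
rewrite expnS => a_lt; rewrite !w3S.
have := IHk (a %/ 3) _.
have -> : (3 * 3 ^ k - 1 - a) %/ 3 = 3 ^ k - 1 - a %/ 3 by lia.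
have : (3 * 3 ^ k - 1 - a) %% 3 = 2 - a %% 3 by lia.
move=> ->; rewrite ltn_divLR // mulnC a_lt => /(_ isT).
by have := ltn_pmod a (isT : 0 < 3); lia.
Qed.

Lemma odd_w3 k a : a < 3 ^ k -> odd (w3 k a) = odd a.
Proof.
elim: k a => [|k IHk] a.
  by rewrite expn0 ltnS leqn0 => /eqP ->; rewrite w3_0.
rewrite expnS mulnC => a_lt; rewrite w3S oddD IHk ?ltn_divLR //.
by rewrite {3}(divn_eq a 3) oddD oddM andbT addbC.
Qed.

(** Multiplication by 3 modulo [3 ^ m - 1] rotates the [m] digits; the bound on [j] excludes the
    all-2 number, which would reduce to 0. *)
Lemma w3_rot m j : 0 < m -> j < 3 ^ m - 1 -> w3 m ((3 * j) %% (3 ^ m - 1)) = w3 m j.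
Proof.
case: m => // m _; rewrite expnS => j_lt.
have p_gt0 : 0 < 3 ^ m by rewrite expn_gt0.
set b := j %/ 3 ^ m; set a := j %% 3 ^ m.
have jE : j = a + 3 ^ m * b by rewrite /a /b mulnC addnC -divn_eq.
have a_lt : a < 3 ^ m by rewrite ltn_pmod.
have b_lt : b < 3 by rewrite ltn_divLR //; lia.
have -> : (3 * j) %% (3 * 3 ^ m - 1) = b + 3 ^ 1 * a.
  have -> : 3 * j = b * (3 * 3 ^ m - 1) + (b + 3 ^ 1 * a) by rewrite jE expn1; nia.
  rewrite modnMDl modn_small // expn1.
  case: (ltnP b 2) => hb; first by lia.
  have b2 : b = 2 by lia.
  by rewrite jE b2 in j_lt; lia.
have -> : w3 m.+1 j = w3 m a + w3 1 b by rewrite {1}jE -(addn1 m) w3_block.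
by rewrite -(add1n m) w3_block // addnC.
Qed.

(** * Counting integers by digit sum modulo 4 *)

Definition wcount (m : nat) (P : pred nat) :=
  count (fun j => P (w3 m j %% 4)) (iota 0 (3 ^ m)).

Lemma wcountS m P : wcount m.+1 P =
  wcount m (fun r => P (r %% 4)) + wcount m (fun r => P (r.+1 %% 4))
  + wcount m (fun r => P (r.+2 %% 4)).
Proof.
rewrite /wcount expnS.
have E (q : pred nat) N : count q (iota 0 (3 * N)) =
  count (fun j => q (3 * j)) (iota 0 N) + count (fun j => q (3 * j).+1) (iota 0 N)
   + count (fun j => q (3 * j).+2) (iota 0 N).
  elim: N => [|N IHN] //.
  have -> : 3 * N.+1 = 3 * N + 3 by lia.
  by rewrite -[N.+1]addn1 (iotaD 0 (3 * N)) (iotaD 0 N) !count_cat IHN !add0n /= !addn0; lia.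
rewrite E; congr (_ + _ + _); apply: eq_count => j /=; congr (P _); rewrite w3S.
- have -> : (3 * j) %/ 3 = j by lia.
  lia.
- have -> : (3 * j).+1 %/ 3 = j by lia.
  lia.
- have -> : (3 * j).+2 %/ 3 = j by lia.
  lia.
Qed.

(** One more digit turns the class sizes [N_r] into [N_r + N_(r-1) + N_(r-2)], indices modulo 4.
    Summing two adjacent classes gives the total [3 ^ m] plus two adjacent old classes, so the pairs
    2, 3 and 1, 2 form a closed system. *)
Lemma wcount_step m :
  wcount m.+1 (fun r => (r == 2) || (r == 3))
    = 3 ^ m + wcount m (fun r => (r == 1) || (r == 2))
  /\ wcount m.+1 (fun r => (r == 1) || (r == 2))
       + wcount m (fun r => (r == 2) || (r == 3)) = 2 * 3 ^ m.
Proof.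
rewrite -[3 ^ m](size_iota 0) !wcountS /wcount.
split; elim: (iota _ _) => //= j s; case: (w3 m j %% 4) (ltn_pmod (w3 m j) (isT : 0 < 4)).
all: by do 4?[case=> //=]; lia.
Qed.

(** Two steps of the recursion send the count [A] to [5 * 3 ^ m - A], so [2 * A - 3 ^ m] changes
    sign; it is -1 for [m = 1]. *)
Lemma wcount23 m :
  (m %% 4 = 1 -> 2 * wcount m (fun r => (r == 2) || (r == 3)) + 1 = 3 ^ m) /\
  (m %% 4 = 3 -> 2 * wcount m (fun r => (r == 2) || (r == 3)) = 3 ^ m + 1).
Proof.
suff H q : 2 * wcount (4 * q).+1 (fun r => (r == 2) || (r == 3)) + 1 = 3 ^ (4 * q).+1.
  split=> hm; first by have -> : m = (4 * (m %/ 4)).+1 by lia; apply: H.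
  have -> : m = (4 * (m %/ 4)).+3 by lia.
  have := H (m %/ 4); have [-> _] := wcount_step (4 * (m %/ 4)).+2.
  have [_] := wcount_step (4 * (m %/ 4)).+1; rewrite !(expnS 3); lia.
elim: q => [|q IHq]; first by rewrite muln0 /wcount /= !w3S /w3 !big_ord0.
rewrite mulnS add4n.
have [-> _] := wcount_step (4 * q).+4; have [_ +] := wcount_step (4 * q).+3.
have [-> _] := wcount_step (4 * q).+2; have [_ +] := wcount_step (4 * q).+1.
move: IHq; rewrite !(expnS 3); lia.
Qed.

Lemma size_Tset23 m : 3 <= m -> odd m ->
  (m %% 4 = 1 -> size (Tset 2 3 m) = (3 ^ m - 1 - 2) %/ 2) /\
  (m %% 4 = 3 -> size (Tset 2 3 m) = (3 ^ m - 1) %/ 2).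
Proof.
move=> m_ge3 m_odd.
have p_gt : 3 < 3 ^ m by rewrite -{1}(expn1 3) ltn_exp2l //; lia.
(* [Tset] omits both ends of the range: 0 is not counted anyway, but [3 ^ m - 1] has digit sum
   [2 * m], which is 2 modulo 4 for odd [m]. *)
have -> : size (Tset 2 3 m) = wcount m (fun r => (r == 2) || (r == 3)) - 1.
  rewrite size_filter /wcount.
  have {2}-> : 3 ^ m = 1 + (3 ^ m - 2) + 1 by lia.
  rewrite !iotaD !count_cat /= w3_0 mod0n /= add0n addn0.
  have -> : 0 + (1 + (3 ^ m - 2)) = 3 ^ m - 1 by lia.
  have := @w3_compl m (3 ^ m - 1) _; rewrite subnn w3_0 addn0 => -> //; last by lia.
  have -> : m.*2 %% 4 = 2 by rewrite -{1}(odd_double_half m) m_odd; lia.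
  by rewrite /= addnK.
by have [h1 h3] := wcount23 m; split=> hm; [have := h1 hm | have := h3 hm]; lia.
Qed.

(** * Progressions of exponents with low digit sum *)

Definition low m e := w3 m (e %% (3 ^ m - 1)) %% 4 <= 1.

Lemma low_mod m e q j : e = j + q * (3 ^ m - 1) -> j < 3 ^ m - 1 ->
  w3 m j %% 4 <= 1 -> low m e.
Proof.
by move=> -> j_lt; rewrite /low addnC modnMDl (modn_small j_lt).
Qed.

Lemma w3_blocks k a b c : a < 3 ^ k -> b < 3 ^ k -> c < 3 ->
  w3 k.*2.+1 (a + 3 ^ k * (b + 3 ^ k * c)) = w3 k a + w3 k b + c.
Proof.
move=> a_lt b_lt c_lt; rewrite -addnn -addnS w3_block // -addn1 w3_block // addnA.
by rewrite [w3 1 c]w3S modn_small // divn_small // w3_0 addn0.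
Qed.

Lemma w3_lt9 k s : 2 <= k -> s < 9 -> w3 k s = s %% 3 + s %/ 3.
Proof.
move=> /subnKC <- s_lt; rewrite w3_widen // !w3S.
by rewrite [w3 0 _]big_ord0 addn0 (@modn_small (s %/ 3)) // ltn_divLR.
Qed.

(** The bound on [b + c] bites only for [c = 2], where it forbids [b = 3 ^ k - 1] and so keeps the
    number below the modulus. *)
Lemma low_blocks k e q a b c :
    e = a + 3 ^ k * (b + 3 ^ k * c) + q * (3 ^ k.*2.+1 - 1) ->
    a < 3 ^ k -> b < 3 ^ k -> c < 3 -> b + c <= 3 ^ k ->
  (w3 k a + w3 k b + c) %% 4 <= 1 -> low k.*2.+1 e.
Proof.
move=> eE a_lt b_lt c_lt bc_le w_low.
apply: (low_mod eE); last by rewrite w3_blocks.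
rewrite expnS -addnn expnD.
move: (3 ^ k) a_lt b_lt bc_le {eE w_low} => x a_lt b_lt bc_le.
case: (ltnP c 2) => c2.
  have : x * (b + x * c) <= x * (x.-1 + x * 1).
    by rewrite leq_mul2l leq_add ?orbT //; [lia | rewrite leq_mul2l; lia].
  case: x {b_lt bc_le} a_lt => // y. nia.
have -> : c = 2 by lia.
have : x * (b + x * 2) <= x * (x - 2 + x * 2) by rewrite leq_mul2l leq_add2r; lia.
have [y xE] : exists y, x = y.+2 by exists (x - 2); lia.
by rewrite xE in a_lt b_lt bc_le *; nia.
Qed.

(** When [N.*2] is the modulus, an odd multiple of the step [N + y] keeps one [N] and an even
    multiple keeps none. *)
Lemma addmul_odd N y r : (N + y) * r.*2.+1 = N + y * r.*2.+1 + r * N.*2.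
Proof. lia. Qed.

Lemma addmul_even N y r : (N + y) * r.*2 = y * r.*2 + r * N.*2.
Proof. lia. Qed.

(** In base 3, [h] consists of [k] ones and half of the modulus of [2 * k + 1] ones. *)
Lemma pow3_half k h : 3 ^ k = h.*2.+1 ->
  3 ^ k.*2.+1 - 1 = (h + 3 ^ k * (h + 3 ^ k * 1)).*2.
Proof. by move=> hE; rewrite expnS -(addnn k) expnD hE; lia. Qed.

Lemma odd_pow3_half k h : 3 ^ k = h.*2.+1 -> odd h = odd k.
Proof.
elim: k h => [|k IHk] h; first by rewrite expn0; case: h.
rewrite expnS => e; have hh : 3 ^ k = (h %/ 3).*2.+1 by lia.
by have := IHk _ hh; rewrite /=; lia.
Qed.

(** Even [t] gives the blocks [t, t, 0] and odd [t <= h] the blocks [h + t, h + t, 1]. The repeated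
    block is an even number, so its digit sum is even and counts twice, hence 0 modulo 4. *)
Lemma low_run3 k h t : 3 ^ k = h.*2.+1 -> odd k -> 3 <= k -> t < h + 6 ->
  low k.*2.+1 ((h + 3 ^ k * (h + 3 ^ k * 1) + (3 ^ k).+1) * t).
Proof.
move=> hE k_odd k_ge3 t_lt.
have h_odd : odd h by rewrite (odd_pow3_half hE).
have h_ge : 13 <= h.
  have : 3 ^ 3 <= 3 ^ k by rewrite leq_exp2l.
  by rewrite hE; lia.
have nE := pow3_half hE.
have [r rE] : exists r, r = t./2 by eexists.
case: (boolP (odd t)) => t_odd.
- have tE : t = r.*2.+1 by lia.
  rewrite tE addmul_odd -nE -tE.
  case: (leqP t h) => th.
  + apply: (@low_blocks _ _ r (h + t) (h + t) 1) => //; rewrite ?hE; try lia.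
    have := @odd_w3 k (h + t) _; rewrite hE oddD h_odd t_odd; lia.
  (* Here [h + t = 3 ^ k + s] carries into the block above and then into the top digit. Parity
     leaves [s = 1] and [s = 3], both of digit sum 5; [s = 5] would give 7. *)
  + have [s sE] : exists s, t = h + 1 + s by exists (t - (h + 1)); lia.
    apply: (@low_blocks _ _ r s s.+1 2) => //; rewrite ?hE; try lia.
    have s_cases : s = 1 \/ s = 3 by lia.
    by case: s_cases => ->; rewrite !w3_lt9 //; lia.
- have tE : t = r.*2 by lia.
  rewrite tE addmul_even -nE -tE.
  apply: (@low_blocks _ _ r t t 0) => //; rewrite ?hE; try lia.
  have := @odd_w3 k t _; rewrite hE; lia.
Qed.

(* The exponents are [u * (i - 1)] with [u = n / 2 + (3 ^ k - 1)]. *)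
Lemma low_run1 k h i : 3 ^ k = h.*2.+1 -> ~~ odd k -> 2 <= k -> i < h + 7 ->
  low k.*2.+1 (h.+1 + 3 ^ k * (h.-1 + 3 ^ k * 1)
               + (h + 3 ^ k * (h + 3 ^ k * 1) + h.*2) * i).
Proof.
move=> hE k_even k_ge2 i_lt.
have h_even : ~~ odd h by rewrite (odd_pow3_half hE).
have h_ge : 4 <= h.
  have : 3 ^ 2 <= 3 ^ k by rewrite leq_exp2l.
  by rewrite hE; lia.
have nE := pow3_half hE.
have [g hg] : exists g, h = g.+4 by exists (h - 4); lia.
(* Two complementary blocks contribute [k.*2], which vanishes modulo 4 because [k] is even. *)
have k4 : k.*2 %% 4 = 0 by lia.
have compl a b : a + b = h.*2 -> w3 k a + w3 k b = k.*2.
  move=> ab; have -> : b = 3 ^ k - 1 - a by rewrite hE; lia.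
  by rewrite w3_compl // hE; lia.
case: i i_lt => [|t] t_lt.
  rewrite muln0.
  apply: (@low_blocks _ _ 0 h.+1 h.-1 1); rewrite ?hE ?compl; lia.
have {}t_lt : t <= h + 5 by lia.
have -> : h.+1 + 3 ^ k * (h.-1 + 3 ^ k * 1) + (h + 3 ^ k * (h + 3 ^ k * 1) + h.*2) * t.+1
   = (h + 3 ^ k * (h + 3 ^ k * 1) + h.*2) * t + (3 ^ k.*2.+1 - 1).
  rewrite mulnS nE hE; rewrite hg /=; lia.
have [r rE] : exists r, r = t./2 by eexists.
case: (boolP (odd t)) => t_odd.
- have tE : t = r.*2.+1 by lia.
  rewrite tE addmul_odd -nE -tE -addnA -mulSnr.
  case: (leqP t h) => th.
  + have [d dE] : exists d, h = t + d by exists (h - t); lia.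
    apply: (@low_blocks _ _ r.+1 d (h + t) 1); rewrite ?hE ?compl; lia.
  (* The lowest block now borrows from the middle one, which itself overflows once [s > 0]. For
     [s = 2] and [s = 4] the digit sum is [k.*2 - 2 + 1 + 2]. *)
  + have [s sE] : exists s, t = h + 1 + s by exists (t - (h + 1)); lia.
    have s_cases : s = 0 \/ s = 2 \/ s = 4 by lia.
    case: s_cases => [s0|s24].
    * apply: (@low_blocks _ _ r.+1 h.*2 h.*2 1); rewrite ?hE; try lia.
      have := compl 0 h.*2; rewrite w3_0; lia.
    * apply: (@low_blocks _ _ r.+1 (h.*2 - s) s.-1 2); rewrite ?hE; try lia.
      have := compl (h.*2 - s) s.
      by case: s24 => -> /=; rewrite (w3_lt9 k_ge2 (isT : 1 < 9)) (w3_lt9 k_ge2 (isT : 2 < 9))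
         || rewrite (w3_lt9 k_ge2 (isT : 3 < 9)) (w3_lt9 k_ge2 (isT : 4 < 9)); lia.
- have tE : t = r.*2 by lia.
  rewrite tE addmul_even -nE -tE -addnA -mulSnr.
  case: (posnP t) => [t0|t_gt0].
    apply: (@low_blocks _ _ r.+1 0 0 0); rewrite ?hE ?w3_0 ?t0 //; lia.
  (* The blocks of [t * (3 ^ k - 1)] are [3 ^ k - t] and [t - 1], again complementary. *)
  have [s sE] : exists s, h.*2.+1 = t + s by exists (h.*2.+1 - t); lia.
  apply: (@low_blocks _ _ r.+1 s t.-1 0); rewrite ?hE ?compl; try lia.
Qed.

(** A common divisor is odd, since [N + y] is, and divides [y.*2], hence [y], hence [c], hence 2. *)
Lemma coprime_half_add N y c q : odd N -> ~~ odd y -> N.*2 = y * q + c -> c %| 2 ->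
  coprime N.*2 (N + y).
Proof.
move=> N_odd y_even E c_dvd2; set d := gcdn N.*2 (N + y).
have d_odd : odd d.
  by apply: (dvdn_odd (dvdn_gcdr _ _)); rewrite oddD N_odd (negbTE y_even).
have d_dvd_y : d %| y.
  have : d %| y.*2.
    have -> : y.*2 = (N + y).*2 - N.*2 by lia.
    by rewrite dvdn_sub ?dvdn_gcdl // -mul2n dvdn_mull ?dvdn_gcdr.
  by rewrite -mul2n Gauss_dvdr // coprimen2.
have d_dvd_c : d %| c.
  by rewrite -(dvdn_addr c (dvdn_mulr q d_dvd_y)) -E dvdn_gcdl.
have : d %| 2 := dvdn_trans d_dvd_c c_dvd2.
by move/(dvdn_leq (isT : 0 < 2)); rewrite /coprime -/d; lia.
Qed.

(** * The embedding of the prime field and Frobenius descent *)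

Local Open Scope ring_scope.

(* [f3emb] is a ring morphism only in characteristic 3, hence the proof argument. *)
Definition f3m (L : fieldType) of 3%N \in [pchar L] := @f3emb L.

Section F3Embedding.
Variables (L : fieldType) (ch : 3%N \in [pchar L]).

Fact f3m_is_nmod_morphism : nmod_morphism (f3m ch).
Proof.
split=> // x y; rewrite /f3m /f3emb -natrD -(GRing.natr_mod_pchar ch (_ + _)%N).
by congr (_ %:R).
Qed.

Fact f3m_is_monoid_morphism : monoid_morphism (f3m ch).
Proof.
split=> // x y; rewrite /f3m /f3emb -natrM -(GRing.natr_mod_pchar ch (_ * _)%N).
by congr (_ %:R).
Qed.

HB.instance Definition _ :=
  GRing.isNmodMorphism.Build 'F_3 L (f3m ch) f3m_is_nmod_morphism.
HB.instance Definition _ :=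
  GRing.isMonoidMorphism.Build 'F_3 L (f3m ch) f3m_is_monoid_morphism.

Lemma cube_fixed_f3m (x : L) : x ^+ 3 = x -> exists y, x = f3m ch y.
Proof.
move=> x3; have : x * (x - 1) * (x + 1) == 0.
  by rewrite -mulrA -subr_sqr_1 mulrBr mulr1 -exprS x3 subrr.
rewrite !mulf_eq0 subr_eq0 addr_eq0 -orbA => /or3P[] /eqP ->.
- by exists 0; rewrite rmorph0.
- by exists 1; rewrite rmorph1.
- by exists (-1); rewrite rmorphN1.
Qed.

Lemma f3m_cube (y : 'F_3) : f3m ch y ^+ 3 = f3m ch y.
Proof.
rewrite -rmorphXn; congr (f3m ch _).
by case: y => [[|[|[|]]] // i]; apply/val_inj.
Qed.

Lemma poly_cube_fixed (p : {poly L}) :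
  map_poly (pFrobenius_aut ch) p = p -> exists q, p = map_poly (f3m ch) q.
Proof.
move=> pE; have ex i : exists y : 'F_3, p`_i == f3m ch y.
  have [|y ->] := @cube_fixed_f3m p`_i; last by exists y.
  by rewrite -{2}pE coef_map /= pFrobenius_autE.
exists (\poly_(i < size p) xchoose (ex i)).
apply/polyP=> i; rewrite coef_map coef_poly.
case: ltnP => hi; first exact/eqP/(xchooseP (ex i)).
by rewrite nth_default ?rmorph0.
Qed.

Lemma wpoly_map N (c : 'rV['F_3]_N) : wpoly L c = map_poly (f3m ch) (rVpoly c).
Proof.
rewrite /wpoly; apply/polyP=> i; rewrite coef_map coef_sum coef_rVpoly.
case: insubP => [j _ ji|].
  rewrite (bigD1 j) //= big1 ?addr0 => [|l lj]; rewrite coefCM coefXn.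
    by rewrite -ji eqxx mulr1.
  by rewrite -ji (inj_eq val_inj) eq_sym (negbTE lj) mulr0.
rewrite -leqNgt => hi; rewrite [RHS]rmorph0 big1 // => l _.
by rewrite coefCM coefXn gtn_eqF ?mulr0 // (leq_trans (ltn_ord l)).
Qed.

(** Coefficients in the prime field are fixed by cubing, so the zeros of a word are closed under
    tripling the exponent. *)
Lemma wpoly_cube N (c : 'rV['F_3]_N) (x : L) : (wpoly L c).[x ^+ 3] = (wpoly L c).[x] ^+ 3.
Proof.
rewrite /wpoly !horner_sum -(pFrobenius_autE ch) rmorph_sum; apply: eq_bigr => i _.
rewrite !hornerCM !hornerXn rmorphM /= !pFrobenius_autE -/(f3m ch _) f3m_cube.
by rewrite -!exprM mulnC.
Qed.

End F3Embedding.

(** * Lower bounds on the weight *)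

Lemma horner_wpoly (L : fieldType) N (c : 'rV['F_3]_N) (x : L) :
  (wpoly L c).[x] = \sum_(i < N) f3emb L (c ord0 i) * x ^+ i.
Proof. by rewrite horner_sum; apply: eq_bigr => i _; rewrite hornerCM hornerXn. Qed.

(* The matrix [wpoly c (x ^ (a i + s j))] factors through the support of [c],
   so its rank is at most the weight of [c]. *)
Lemma hwt_ge_triangular (L : fieldType) N (c : 'rV['F_3]_N) (x : L) d (a s : nat -> nat) :
    (forall i j, (i < j < d)%N -> (wpoly L c).[x ^+ (a i + s j)] = 0) ->
    (forall i, (i < d)%N -> (wpoly L c).[x ^+ (a i + s i)] != 0) ->
  (d <= hwt c)%N.
Proof.
move=> zero nonzero.
pose S := [set i | c ord0 i != 0].
pose A := \matrix_(i < d, y < #|S|) (x ^+ a i) ^+ enum_val y.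
pose B := \matrix_(y < #|S|, j < d)
  (f3emb L (c ord0 (enum_val y)) * (x ^+ s j) ^+ enum_val y).
have ABE i j : (A *m B) i j = (wpoly L c).[x ^+ (a i + s j)].
  rewrite mxE horner_wpoly (bigID [in S]) /= [X in _ + X]big1 ?addr0; last first.
    by move=> y; rewrite inE negbK => /eqP ->; rewrite mul0r.
  rewrite [RHS]big_enum_val; apply: eq_bigr => y _; rewrite !mxE.
  by rewrite exprD exprMn mulrCA mulrA.
have AB_trig : is_trig_mx (A *m B).
  by apply/is_trig_mxP => i j ij; rewrite ABE zero // ij ltn_ord.
have /mxrank_unit <- : A *m B \in unitmx.
  rewrite unitmxE det_trig // unitfE prodf_seq_neq0.
  by apply/allP => i _ /=; rewrite ABE nonzero.
exact: mulmx_max_rank.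
Qed.

(** The BCH bound, with a nonzero syndrome on the progression in place of a coprimality condition.
    If [t] is the first such index, entry [(i, j)] of the matrix is the syndrome at index
    [t + i - j]: zero above the diagonal by minimality, nonzero on it. *)
Lemma hwt_ge_run (L : fieldType) N (c : 'rV['F_3]_N) (x : L) d b u :
    (forall i, (i < d)%N -> (wpoly L c).[x ^+ (b + u * i)] = 0) ->
    (exists t, (wpoly L c).[x ^+ (b + u * t)] != 0) ->
  (d < hwt c)%N.
Proof.
move=> run ex; case: (ex_minnP ex) => t nz t_min.
have dt : (d <= t)%N by case: leqP => // td; rewrite run ?eqxx in nz.
apply: (@hwt_ge_triangular L N c x d.+1 (fun i => u * i)%N (fun j => b + u * (t - j))%N).
  move=> i j /andP[ij jd].
  have -> : (u * i + (b + u * (t - j)) = b + u * (t + i - j))%N.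
    by rewrite addnCA -mulnDr; congr (_ + _ * _)%N; lia.
  by apply/eqP; case: eqP => // /eqP /t_min; lia.
move=> i id; suff -> : (u * i + (b + u * (t - i)) = b + u * t)%N by [].
by rewrite addnCA -mulnDr; congr (_ + _ * _)%N; lia.
Qed.

(** * Existence of a nonzero syndrome *)

Section Syndromes.
Variables (L : fieldType) (ch : 3%N \in [pchar L]) (N : nat) (beta : L).
Hypothesis prim : N.-primitive_root beta.

Lemma wpoly_neq0 (c : 'rV['F_3]_N) : c != 0 -> exists j, (wpoly L c).[beta ^+ j] != 0.
Proof.
move=> c0.
have [/existsP[j]|] := boolP [exists j : 'I_N, (wpoly L c).[beta ^+ j] != 0].
  by exists j.
rewrite negb_exists => /forallP all0; case/eqP: c0.
suff /eqP : wpoly L c = 0.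
  by rewrite (wpoly_map ch) map_poly_eq0 => /eqP c0; rewrite -[c]rVpolyK c0 linear0.
apply: (@roots_geq_poly_eq0 _ _ [seq beta ^+ i | i <- index_iota 0 N]).
- apply/allP=> _ /mapP[i + ->]; rewrite mem_index_iota => iN.
  by have := all0 (Ordinal iN); rewrite negbK.
- by rewrite map_inj_in_uniq ?iota_uniq // => i j; rewrite !mem_index_iota => iN jN
    /eqP; rewrite (eq_prim_root_expr prim) !modn_small // => /eqP.
- rewrite size_map size_iota subn0 (wpoly_map ch) size_map_poly.
  exact: size_poly.
Qed.

Lemma wpoly_neq0_coprime (c : 'rV['F_3]_N) b u : c != 0 -> (0 < u)%N -> coprime N u ->
  exists t, (wpoly L c).[beta ^+ (b + u * t)] != 0.
Proof.
move=> /wpoly_neq0[j nz] u_gt0 co.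
(* The remainder theorem places an exponent congruent to [j] on the progression; the added multiple
   of [N * u] makes [e - b] an exact subtraction. *)
pose e := (chinese N u j b + b * (N * u))%N.
have N_gt0 := prim_order_gt0 prim.
have be : (b <= e)%N by rewrite (leq_trans _ (leq_addl _ _)) // leq_pmulr // muln_gt0 N_gt0.
have ue : (u %| e - b)%N.
  by rewrite -eqn_mod_dvd // /e mulnA addnC modnMDl chinese_modr.
exists ((e - b) %/ u)%N; rewrite mulnC divnK // subnKC //.
suff /eqP -> : beta ^+ e == beta ^+ j by [].
by rewrite (eq_prim_root_expr prim) /e mulnCA mulnC addnC modnMDl chinese_modl.
Qed.
End Syndromes.

(** * The cyclic code, its dual and their zeros *)

Lemma mem_Tset i1 i2 m j : (0 < m)%N ->
  (j \in Tset i1 i2 m) =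
  ((0 < j < 3 ^ m - 1) && ((w3 m j %% 4 == i1) || (w3 m j %% 4 == i2)))%N.
Proof.
move=> m_gt0; rewrite mem_filter mem_iota andbC; congr (_ && _).
have : (3 ^ 1 <= 3 ^ m)%N by rewrite leq_exp2l.
by rewrite expn1 => h; congr (_ && (_ < _)%N); lia.
Qed.

Section CyclicCode.
Variables (m : nat) (L : finFieldType) (ch : 3%N \in [pchar L]) (alpha : L).
Hypothesis m_gt0 : (0 < m)%N.
Let n := (3 ^ m - 1)%N.
Hypothesis prim : n.-primitive_root alpha.
Variables i1 i2 : nat.
Let T := Tset i1 i2 m.

Lemma Tset_lt j : j \in T -> (j < n)%N.
Proof. by rewrite mem_Tset // => /andP[/andP[]]. Qed.

Lemma Tset_uniq : uniq T.
Proof. by rewrite filter_uniq ?iota_uniq. Qed.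

Lemma alpha_inj_in (s : seq nat) :
  {in s, forall j, j < n}%N -> {in s &, injective (GRing.exp alpha)}.
Proof.
move=> s_lt i j /s_lt ilt /s_lt jlt /eqP.
by rewrite (eq_prim_root_expr prim) !modn_small // => /eqP.
Qed.

(** Frobenius maps the root [alpha ^+ j] to [alpha ^+ (3 * j)], and tripling modulo [n] permutes [T]
    because it only rotates digits. This is what puts the generator over ['F_3]. *)
Lemma gpoly_frob :
  map_poly (pFrobenius_aut ch) (gpoly alpha i1 i2 m) = gpoly alpha i1 i2 m.
Proof.
rewrite /gpoly rmorph_prod /=.
pose f j := ((3 * j) %% n)%N.
transitivity (\prod_(j <- [seq f j | j <- T]) ('X - (alpha ^+ j)%:P)).
  rewrite big_map; apply: eq_bigr => j _.
  rewrite rmorphB /= map_polyX map_polyC /= pFrobenius_autE -exprM mulnC.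
  by rewrite /f (prim_expr_mod prim).
have f_sub : {subset [seq f j | j <- T] <= T}.
  move=> _ /mapP[j jT ->]; have jn := Tset_lt jT.
  move: jT; rewrite !mem_Tset // => /andP[/andP[j_gt0 _] jw].
  have n_gt0 : (0 < n)%N by apply: leq_ltn_trans jn.
  rewrite w3_rot // jw andbT ltn_pmod // andbT lt0n -/(dvdn n (3 * j)) Gauss_dvdr.
    by apply/negP => /(dvdn_leq j_gt0); lia.
  rewrite /n coprime_sym prime_coprime // -(prednK m_gt0) expnS; apply/negP => h.
  by move: n_gt0 h; rewrite /n -(prednK m_gt0) expnS; lia.
have f_uniq : uniq [seq f j | j <- T].
  rewrite map_inj_in_uniq ?Tset_uniq // => i j iT jT fij.
  apply: (@alpha_inj_in T) => //; first exact: Tset_lt.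
  apply: (fmorph_inj (pFrobenius_aut ch)).
  rewrite /= !pFrobenius_autE -!exprM ![(_ * 3)%N]mulnC.
  by rewrite -(prim_expr_mod prim) -[RHS](prim_expr_mod prim); congr (_ ^+ _).
apply: perm_big; apply: uniq_perm; rewrite ?Tset_uniq //.
by have [] := uniq_min_size f_uniq f_sub; rewrite ?size_map.
Qed.

Lemma size_gpoly : size (gpoly alpha i1 i2 m) = (size T).+1.
Proof.
rewrite /gpoly -(big_map (GRing.exp alpha) xpredT (fun z => 'X - z%:P)).
by rewrite size_prod_XsubC size_map.
Qed.

Lemma gpoly_dvd (p : {poly L}) :
  {in T, forall j, root p (alpha ^+ j)} -> gpoly alpha i1 i2 m %| p.
Proof.
move=> rp; rewrite /gpoly -(big_map (GRing.exp alpha) xpredT (fun z => 'X - z%:P)).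
apply: uniq_roots_dvdp; first by apply/allP => _ /mapP[j jT ->]; apply: rp.
by rewrite uniq_rootsE map_inj_in_uniq ?Tset_uniq //; apply: alpha_inj_in; apply: Tset_lt.
Qed.

Lemma size_Tset_le : (size T <= n)%N.
Proof.
rewrite -[n]subn0 -(size_iota 0 (n - 0)); apply: uniq_leq_size Tset_uniq _ => j jT.
by rewrite mem_iota /= add0n subn0 Tset_lt.
Qed.

Variable g0 : {poly 'F_3}.
Hypothesis gE : gpoly alpha i1 i2 m = map_poly (f3m ch) g0.

Lemma size_g0 : size g0 = (size T).+1.
Proof. by rewrite -size_gpoly gE size_map_poly. Qed.

Lemma g0_neq0 : g0 != 0.
Proof. by rewrite -size_poly_eq0 size_g0. Qed.

Definition genmx : 'M['F_3]_(n - size T, n) := \matrix_i poly_rV (g0 * 'X^i).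

Lemma size_g0M (q : {poly 'F_3}) :
  (size q <= n - size T)%N -> (size (g0 * q)%R <= n)%N.
Proof.
move=> hq; apply: leq_trans (size_polyMleq _ _) _; rewrite size_g0 addSn /=.
by rewrite -[X in (_ <= X)%N](subnKC size_Tset_le) leq_add2l.
Qed.

Lemma cyc_codeE c : (c \in cyc_code alpha i1 i2 m) = (g0 %| rVpoly c).
Proof. by rewrite inE (wpoly_map ch) gE dvdp_map. Qed.

Lemma mul_genmx (u : 'rV_(n - size T)) : u *m genmx = poly_rV (g0 * rVpoly u).
Proof.
rewrite /rVpoly poly_def mulr_sumr linear_sum mulmx_sum_row; apply: eq_bigr => i _.
by rewrite rowK -scalerAr linearZ /= valK.
Qed.

Lemma genmx_row_free : row_free genmx.
Proof.
rewrite -kermx_eq0; apply/eqP/row_matrixP => i; rewrite row0.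
have : row i (kermx genmx) *m genmx = 0 by rewrite -row_mul mulmx_ker row0.
rewrite mul_genmx => h; have := congr1 rVpoly h.
rewrite poly_rV_K ?linear0; last by rewrite size_g0M // size_poly.
move/eqP; rewrite mulf_eq0 (negbTE g0_neq0) /= => /eqP h0.
by rewrite -[LHS]rVpolyK h0 linear0.
Qed.

Lemma cyc_code_genmx c : (c \in cyc_code alpha i1 i2 m) = (c <= genmx)%MS.
Proof.
rewrite cyc_codeE; apply/idP/submxP => [dv|[u ->]].
  have qE := divpK dv.
  have sq : (size (rVpoly c %/ g0)%R <= n - size T)%N.
    rewrite size_divp ?g0_neq0 // size_g0 /=.
    by rewrite leq_sub2r // size_poly.
  exists (poly_rV (rVpoly c %/ g0)); rewrite mul_genmx poly_rV_K // mulrC qE.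
  by rewrite rVpolyK.
by rewrite mul_genmx poly_rV_K ?dvdp_mulr // size_g0M // size_poly.
Qed.

Lemma dual_cyc_code v :
  (v \in dual_code (cyc_code alpha i1 i2 m)) = (v *m genmx^T == 0).
Proof.
have dotE (a b : 'rV['F_3]_n) : \sum_(i < n) a ord0 i * b ord0 i = (a *m b^T) 0 0.
  by rewrite mxE; apply: eq_bigr => i _; rewrite mxE.
rewrite inE; apply/forall_inP/eqP => [h|h c].
  apply/rowP => j; rewrite [RHS]mxE.
  have /h /eqP <- : row j genmx \in cyc_code alpha i1 i2 m by rewrite cyc_code_genmx row_sub.
  by rewrite mxE; apply: eq_bigr => x _; rewrite !mxE.
rewrite cyc_code_genmx => /submxP[u ->].
by rewrite dotE trmx_mul mulmxA h mul0mx mxE.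
Qed.

(** The dual is the kernel of multiplication by [genmx^T], which is onto since [genmx] is row free;
    rank-nullity gives the dimension. *)
Lemma dim_dual_cyc_code : code_dim (dual_code (cyc_code alpha i1 i2 m)) = size T.
Proof.
pose f : 'Hom('rV['F_3]_n, 'rV['F_3]_(n - size T)) := linfun (mulmxr genmx^T).
have fE v : f v = v *m genmx^T by rewrite lfunE.
have spanE : <<enum (dual_code (cyc_code alpha i1 i2 m))>>%VS = lker f.
  apply/eqP; rewrite eqEsubv; apply/andP; split.
    by apply/span_subvP => v; rewrite mem_enum dual_cyc_code memv_ker fE.
  apply/subvP => v; rewrite memv_ker fE -dual_cyc_code => vC.
  by rewrite memv_span // mem_enum.
have imE : limg f = fullv.
  apply/vspaceP => u; rewrite memvf; apply/memv_imgP.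
  have /submxP[w ->] : (u <= genmx^T)%MS.
    by rewrite submx_full // /row_full mxrank_tr; apply: genmx_row_free.
  by exists w; rewrite ?memvf ?fE.
have := limg_ker_dim f fullv.
rewrite capfv imE !dimvf /dim /= !mul1n /code_dim spanE => E.
by apply/eqP; rewrite -(eqn_add2r (n - size T)) E subnKC // size_Tset_le.
Qed.

(* [h] is a multiple of the generator whose coefficients are the powers of
   [alpha ^ j] in reverse order, so orthogonality to [h] is a root condition. *)
Lemma dual_cyc_code_root v j : v \in dual_code (cyc_code alpha i1 i2 m) ->
  (j < n)%N -> j \notin T -> (wpoly L v).[alpha^-1 ^+ j] = 0.
Proof.
move=> vC jn jT; set a := alpha ^+ j.
have n_gt0 : (0 < n)%N by apply: leq_ltn_trans jn.
have an : a ^+ n = 1 by rewrite -exprM mulnC exprM (prim_expr_order prim) expr1n.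
have a0 : a != 0.
  by apply/eqP => a0; move/eqP: an; rewrite a0 expr0n gtn_eqF //= eq_sym oner_eq0.
(* The polynomial [h] below has coefficients in [L], so the inner product with [v] is extended
   linearly to [L]. *)
pose pair (p : {poly L}) := \sum_(x < n) f3m ch (v ord0 x) * p`_x.
have pairX i : (i < n - size T)%N -> pair (gpoly alpha i1 i2 m * 'X^i) = 0.
  move=> ik; move: vC; rewrite dual_cyc_code => /eqP/rowP/(_ (Ordinal ik)).
  rewrite !mxE => /(congr1 (f3m ch)); rewrite rmorph0 rmorph_sum => vi0.
  rewrite -[RHS]vi0; apply: eq_bigr => x _; rewrite !mxE rmorphM; congr (_ * _).
  by rewrite gE -(map_polyXn (f3m ch)) -rmorphM coef_map.
pose h : {poly L} := \sum_(i < n) a%:P ^+ (n.-1 - i) * 'X^i.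
have hE : (a%:P - 'X) * h = 1 - 'X^n.
  by rewrite -subrXX -polyC_exp an.
have hcoef x : (x < n)%N -> h`_x = a ^+ (n.-1 - x).
  move=> xn; rewrite /h coef_sum (bigD1 (Ordinal xn)) //= big1 ?addr0.
    by rewrite -polyC_exp coefCM coefXn eqxx mulr1.
  move=> y yx; rewrite -polyC_exp coefCM coefXn.
  rewrite (_ : (x == y) = false) ?mulr0 //.
  by apply: contraNF yx => /eqP xy; apply/eqP/val_inj.
(* By [hE], every [n]-th root of unity other than [a] is a root of [h], and [j \notin T] keeps [a]
   away from the roots of the generator. *)
have /dvdpP[q hq] : gpoly alpha i1 i2 m %| h.
  apply: gpoly_dvd => l lT; have ln := Tset_lt lT.
  have lj : alpha ^+ l != a.
    by rewrite (eq_prim_root_expr prim) !modn_small //; apply: contraNneq jT => <-.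
  have := congr1 (horner^~ (alpha ^+ l)) hE.
  rewrite hornerM !hornerE -exprM mulnC exprM (prim_expr_order prim) expr1n subrr.
  by move/eqP; rewrite mulf_eq0 subr_eq0 eq_sym (negbTE lj).
have sh : (size h <= n)%N.
  apply: leq_trans (size_sum _ _ _) _; apply/bigmax_leqP => i _.
  rewrite -polyC_exp mul_polyC (leq_trans (size_scale_leq _ _)) // size_polyXn.
  exact: ltn_ord.
have h0 : h != 0.
  apply/eqP => h0; have := hcoef 0%N n_gt0; rewrite h0 coef0 => /eqP.
  by rewrite eq_sym expf_eq0 (negbTE a0) andbF.
have sq : (size q <= n - size T)%N.
  have q0 : q != 0 by apply: contraNneq h0 => q0; rewrite hq q0 mul0r.
  have g0' : gpoly alpha i1 i2 m != 0 by rewrite -size_poly_eq0 size_gpoly.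
  by move: sh; rewrite hq size_mul // size_gpoly addnS
    -[X in (_ <= X)%N](subnK size_Tset_le) leq_add2r.
have pairh : pair h = 0.
  have -> : h = \sum_(i < size q) q`_i *: (gpoly alpha i1 i2 m * 'X^i).
    rewrite hq -{1}[q]coefK poly_def mulr_suml; apply: eq_bigr => i _.
    by rewrite -scalerAl mulrC.
  rewrite /pair (eq_bigr (fun x : 'I_n => \sum_(i < size q) q`_i *
      (f3m ch (v ord0 x) * (gpoly alpha i1 i2 m * 'X^i)`_x))).
    rewrite exchange_big big1 //= => i _; rewrite -mulr_sumr.
    by rewrite [X in _ * X](pairX i) ?mulr0 // (leq_trans (ltn_ord i)).
  move=> x _; rewrite coef_sum mulr_sumr; apply: eq_bigr => i _.
  by rewrite coefZ mulrCA.
(* Up to the unit [a ^+ n.-1], [pair h] is the value of [wpoly L v] at the inverse of [a]. *)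
apply: (mulfI (expf_neq0 n.-1 a0)); rewrite mulr0 -[RHS]pairh /pair horner_wpoly mulr_sumr.
apply: eq_bigr => x _; rewrite hcoef // mulrCA; congr (_ * _).
have xn : (x <= n.-1)%N by have := ltn_ord x; lia.
by rewrite exprVn -/a exprVn -expfB_cond // (negbTE a0).
Qed.
End CyclicCode.

(** * Inverse roots of unity, and shifting sequences for length 26 *)

Lemma prim_root_inv (F : fieldType) n (z : F) :
  n.-primitive_root z -> n.-primitive_root z^-1.
Proof.
move=> pz; have n_gt0 := prim_order_gt0 pz.
have zn := prim_expr_order pz.
have z0 : z != 0.
  by apply/eqP => z0; move/eqP: zn; rewrite z0 expr0n gtn_eqF //= eq_sym oner_eq0.
have -> : z^-1 = z ^+ n.-1.
  by apply: (mulfI z0); rewrite divff // -exprS prednK.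
by rewrite prim_root_exp_coprime // coprime_sym coprimenP.
Qed.

(** The triangular criterion as a boolean test on explicit lists: [Z] holds known zeros, [B] known
    nonzeros, and computation settles each instance. *)
Lemma hwt_ge_shifts (L : fieldType) N (c : 'rV['F_3]_N) (beta : L)
    (Z B a s : seq nat) :
    N.-primitive_root beta ->
    {in Z, forall j, (wpoly L c).[beta ^+ j] = 0} ->
    {in B, forall j, (wpoly L c).[beta ^+ j] != 0} ->
    all (fun j => (((nth 0 a j + nth 0 s j) %% N)%N \in B) &&
        all (fun i => ((nth 0 a i + nth 0 s j) %% N)%N \in Z) (iota 0 j))
      (iota 0 (size a)) ->
  (size a <= hwt c)%N.
Proof.
move=> prim zero nonzero /allP chk.
apply: (@hwt_ge_triangular _ _ _ beta _ (nth 0 a) (nth 0 s)) => [i j /andP[ij ja]|i ia];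
  rewrite -(prim_expr_mod prim).
  have : j \in iota 0 (size a) by rewrite mem_iota.
  by case/chk/andP => _ /allP chkj; apply/zero/chkj; rewrite mem_iota.
have : i \in iota 0 (size a) by rewrite mem_iota.
by case/chk/andP => /nonzero.
Qed.

(* The longest run of zeros is [22, ..., 27], which only gives weight 7. If
   [S 7 = 0] the run grows to [20, ..., 27]; otherwise the lists below were
   found by a search for van Lint-Wilson shifting sequences. *)
Lemma hwt_ge8 (L : fieldType) (ch : 3%N \in [pchar L]) (c : 'rV['F_3]_26) (beta : L) :
    26.-primitive_root beta -> c != 0 ->
    {in [:: 0; 1; 3; 8; 9; 14; 16; 17; 20; 22; 23; 24; 25]%N,
      forall j, (wpoly L c).[beta ^+ j] = 0} ->
  (8 <= hwt c)%N.
Proof.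
move=> prim c0 zero; pose S j := (wpoly L c).[beta ^+ j].
have S_mod j : S (j %% 26)%N = S j by rewrite /S (prim_expr_mod prim).
have S_cube j : S ((j * 3) %% 26)%N = S j ^+ 3 by rewrite S_mod /S exprM (wpoly_cube ch).
(* Three exponents exhaust an orbit under tripling, as 27 is 1 modulo 26. *)
have orbitN j : S j != 0 -> {in [:: j; (j * 3) %% 26; (j * 9) %% 26]%N, forall i, S i != 0}.
  move=> j0 i; have e3 := S_cube j; have e9 := S_cube ((j * 3) %% 26)%N.
  rewrite modnMml -mulnA e3 in e9.
  by rewrite !inE => /or3P[] /eqP ->; rewrite ?e3 ?e9 ?expf_neq0.
have orbit0 j : S j = 0 -> {in [:: j; (j * 3) %% 26; (j * 9) %% 26]%N, forall i, S i = 0}.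
  move=> j0 i; have e3 := S_cube j; have e9 := S_cube ((j * 3) %% 26)%N.
  rewrite modnMml -mulnA e3 in e9.
  by rewrite !inE => /or3P[] /eqP ->; rewrite ?e3 ?e9 j0 ?expr0n.
have join (s1 s2 : seq nat) (P : nat -> Prop) :
    {in s1, forall j, P j} -> {in s2, forall j, P j} -> {in s1 ++ s2, forall j, P j}.
  by move=> h1 h2 j; rewrite mem_cat => /orP[/h1|/h2].
case: (eqVneq (S 7%N) 0) => [/orbit0 z7|/orbitN n7].
  apply: ltnW; apply: (@hwt_ge_run _ _ c beta 8 20 1).
    move=> i i_lt; rewrite -(prim_expr_mod prim).
    by apply: (join _ _ _ zero z7); do 8?[case: i i_lt => [|i] i_lt //].
  exact: (wpoly_neq0_coprime ch prim).
(* The orbit of 7 now supplies nonzeros; that of 2 joins either the zeros or the nonzeros. *)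
case: (eqVneq (S 2%N) 0) => [/orbit0 z2|/orbitN n2].
  by apply: (@hwt_ge_shifts _ _ c beta _ _ [:: 7; 6; 5; 22; 3; 13; 12; 11]%N
    [:: 0; 1; 2; 11; 18; 20; 21; 22]%N prim (join _ _ _ zero z2) n7).
by apply: (@hwt_ge_shifts _ _ c beta _ _ [:: 7; 6; 4; 24; 8; 5; 15; 14]%N
    [:: 0; 1; 2; 20; 10; 16; 18; 19]%N prim zero (join _ _ _ n7 n2)).
Qed.

(** * Distance bounds for the two classes of [m] modulo 4 *)

Section DualDistance.
Variables (m : nat) (L : fieldType) (ch : 3%N \in [pchar L]) (beta : L).
Hypothesis prim : (3 ^ m - 1).-primitive_root beta.
Variable c : 'rV['F_3]_(3 ^ m - 1).
Hypothesis c_neq0 : c != 0.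
Hypothesis c_low : forall e, low m e -> (wpoly L c).[beta ^+ e] = 0.

(** A run of [h + 7] zeros forces weight at least [h + 8], which is half of [3 ^ k + 15]. *)
Lemma hwt_ge_mod1 : (3 <= m)%N -> (m %% 4 = 1)%N ->
  (3 ^ ((m - 1) %/ 2) + 15 <= 2 * hwt c)%N.
Proof.
move=> m_ge3 m1; set k := ((m - 1) %/ 2)%N.
have mE : m = k.*2.+1 by rewrite /k; lia.
have k_even : ~~ odd k by rewrite /k; lia.
have k_ge2 : (2 <= k)%N by rewrite /k; lia.
have [h hE] : exists h, (3 ^ k = h.*2.+1)%N.
  by exists (3 ^ k)./2; rewrite -{1}(odd_double_half (3 ^ k)) oddX orbT.
have h_even : ~~ odd h by rewrite (odd_pow3_half hE).
have h_gt0 : (0 < h)%N.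
  have : (3 ^ 2 <= 3 ^ k)%N by rewrite leq_exp2l.
  by rewrite hE; lia.
suff : (h + 7 < hwt c)%N by rewrite hE; lia.
apply: (@hwt_ge_run _ _ c beta _ (h.+1 + 3 ^ k * (h.-1 + 3 ^ k * 1))
          (h + 3 ^ k * (h + 3 ^ k * 1) + h.*2)).
  by move=> i i_lt; apply: c_low; rewrite mE; apply: low_run1.
apply: (wpoly_neq0_coprime ch prim) => //; first lia.
(* Modulo [3 ^ k - 1], the number [3 ^ k.*2.+1 - 1] is 2; [6 * h.+1] is the quotient. *)
rewrite mE (pow3_half hE); apply: (@coprime_half_add _ _ 2 (6 * h.+1)) => //;
  rewrite ?hE; lia.
Qed.

Lemma hwt_ge_mod3 : (7 <= m)%N -> (m %% 4 = 3)%N ->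
  (3 ^ ((m - 1) %/ 2) + 13 <= 2 * hwt c)%N.
Proof.
move=> m_ge7 m3; set k := ((m - 1) %/ 2)%N.
have mE : m = k.*2.+1 by rewrite /k; lia.
have k_odd : odd k by rewrite /k; lia.
have k_ge3 : (3 <= k)%N by rewrite /k; lia.
have [h hE] : exists h, (3 ^ k = h.*2.+1)%N.
  by exists (3 ^ k)./2; rewrite -{1}(odd_double_half (3 ^ k)) oddX orbT.
have h_odd : odd h by rewrite (odd_pow3_half hE).
suff : (h + 6 < hwt c)%N by rewrite hE; lia.
apply: (@hwt_ge_run _ _ c beta _ 0 (h + 3 ^ k * (h + 3 ^ k * 1) + (3 ^ k).+1)).
  by move=> i i_lt; apply: c_low; rewrite mE; apply: low_run3.
apply: (wpoly_neq0_coprime ch prim) => //; first lia.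
rewrite mE (pow3_half hE); apply: (@coprime_half_add _ _ 2 (6 * h)) => //;
  rewrite ?hE; lia.
Qed.

End DualDistance.

Theorem theorem10 (m : nat) (L : finFieldType) (alpha : L) :
  (3 <= m)%N -> odd m ->
  3%N \in [pchar L] -> #|L| = (3 ^ m)%N ->
  (3 ^ m - 1).-primitive_root alpha ->
  let n := (3 ^ m - 1)%N in
  let Cp := dual_code (cyc_code alpha 2 3 m) in
  ((m %% 4)%N = 1%N ->
     code_dim Cp = ((n - 2) %/ 2)%N /\
     forall c, c \in Cp -> c != 0 -> (3 ^ ((m - 1) %/ 2) + 15 <= 2 * hwt c)%N) /\
  ((m %% 4)%N = 3%N ->
     code_dim Cp = (n %/ 2)%N /\
     forall c, c \in Cp -> c != 0 -> (3 ^ ((m - 1) %/ 2) + 13 <= 2 * hwt c)%N).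
Proof.
move=> m_ge3 m_odd ch _ prim n Cp.
have m_gt0 : (0 < m)%N by apply: leq_trans m_ge3.
have [g0 gE] := poly_cube_fixed (gpoly_frob ch m_gt0 prim 2 3).
have dimE : code_dim Cp = size (Tset 2 3 m) := dim_dual_cyc_code m_gt0 gE.
have [size1 size3] := size_Tset23 m_ge3 m_odd.
have primV := prim_root_inv prim.
(* Low residues are exactly those outside [Tset 2 3 m], and there the dual vanishes at powers of the
   inverse of [alpha]. *)
have Cp_low c : c \in Cp -> forall e, low m e -> (wpoly L c).[alpha^-1 ^+ e] = 0.
  move=> cCp e e_low; rewrite -(prim_expr_mod primV).
  apply: (dual_cyc_code_root m_gt0 prim gE cCp).
    by rewrite ltn_pmod // (prim_order_gt0 prim).
  rewrite mem_Tset //; move: e_low; rewrite /low.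
  by case: (_ %% 4)%N => [|[|]]; rewrite ?andbF.
split=> hm; split=> [|c cCp c0]; rewrite ?dimE; [exact: size1 | | exact: size3 |].
  exact: (hwt_ge_mod1 ch primV c0 (Cp_low c cCp)).
case: (leqP 7 m) => m7; first exact: (hwt_ge_mod3 ch primV c0 (Cp_low c cCp)).
have m3 : m = 3%N by lia.
subst m; have {}Cp_low := Cp_low c cCp.
rewrite (_ : 3 ^ _ + 13 = 2 * 8)%N // leq_mul2l /=.
apply: (hwt_ge8 ch primV c0) => j jZ; apply: Cp_low; move: jZ; rewrite /low !inE.
(* The digit sums of the thirteen listed exponents are computed one by one. *)
by do 12?[case/predU1P => [->|]]; [..|move/eqP ->]; rewrite /= !w3S /w3 big_ord0.
Qed.
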